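(* Let $(M,\widetilde{\varepsilon})$ be a globalizable local Lie group, $n=\dim M$. Then the diagram with rows $$\Lambda^{m,0}_{hor}(M^{(m)})\xrightarrow{\widetilde{d}}\Lambda^{m,1}_{hor}(M^{(m)})\xrightarrow{\widetilde{d}}\cdots\xrightarrow{\widetilde{d}}\Lambda^{m,n}_{hor}(M^{(m)}),\qquad m\ge1,$$ and vertical maps $\delta:\Lambda^{m,k}_{hor}(M^{(m)})\to\Lambda^{m+1,k}_{hor}(M^{(m+1)})$ commutes: $\widetilde{d}\circ\delta=\delta\circ\widetilde{d}$ on $\Lambda^{m,k}_{hor}(M^{(m)})$ for all $m\ge1$ and $0\le k\le n-1$.
   Context: All objects are smooth; $M$ is a connected manifold, $\dim M=n$. A splitting $\widetilde{\varepsilon}$ of $J_1(M\times M)\to M\times M$ assigns smoothly to each $(p,q)\in M\times M$ a 1-arrow (invertible 1-jet) from $p$ to $q$, i.e. a linear isomorphism $\widetilde{\varepsilon}(p,q):T_pM\to T_qM$ with coordinate matrix $\widetilde{\varepsilon}^i_j(x,y)$, compatible with composition and inversion: $\widetilde{\varepsilon}(q,r)\widetilde{\varepsilon}(p,q)=\widetilde{\varepsilon}(p,r)$, $\widetilde{\varepsilon}(q,p)=\widetilde{\varepsilon}(p,q)^{-1}$. $(M,\widetilde{\varepsilon})$ is a local Lie group if the integrability condition $\widetilde{\mathcal R}=0$ of the PDE $\partial f^i/\partial x^j=\widetilde{\varepsilon}^i_j(x,f(x))$ holds identically on $M\times M$, i.e. $\frac{\partial\widetilde{\varepsilon}^a_r}{\partial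 x^s}+\frac{\partial\widetilde{\varepsilon}^a_r}{\partial y^b}\widetilde{\varepsilon}^b_s$ is symmetric in $r,s$; equivalently, for all $p,q$ the PDE has a (unique) local solution with $f(p)=q$. It is globalizable if all local solutions extend (necessarily uniquely) to global diffeomorphisms of $M$. $M^{(m)}=M\times\dots\times M$ ($m$ copies, $m\ge1$). $\Lambda^{m,k}_{hor}(M^{(m)})$ is the space of nonlinear horizontal $k$-forms on $M^{(m)}$: smooth assignments to $(p,q,\dots,t)\in M^{(m)}$ of an ordinary $k$-form at the first point $p$, written $\omega_I(x,y,\dots,z)dx^I$ in coordinates $x,y,\dots,z$ around $p,q,\dots,t$ (with $\omega_Idx^I=\frac1{k!}\omega_{i_1\dots i_k}dx^{i_1}\wedge\dots\wedge dx^{i_k}$). Put $$\widetilde{D}_r\omega_I=\frac{\partial\omega_I}{\partial x^r}+\frac{\partial\omega_I}{\partial y^a}\widetilde{\varepsilon}^a_r(x,y)+\dots+\frac{\partial\omega_I}{\partial z^a}\widetilde{\varepsilon}^a_r(x,z),\qquad\widetilde{d}\omega=\widetilde{D}_r\omega_I\,dx^r\wedge dx^I .$$ Since an $\widetilde{\varepsilon}$-invariant $k$-form on $M$ (one with $\widetilde{\varepsilon}(p,q)_*\alpha(p)=\alpha(q)$ for all $p,q$) is determined by its value at any single point, $\omega$ may be regarded as a function $\omega:M^{(m)}\to\widetilde{\Lambda^k(M)}$ into the space of $\widetilde{\varepsilon}$-invariant $k$-forms. With this interpretation, $$(\delta\omega)(p_0,p_1,\dots,p_m)=\sum_{0\le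 i\le m}(-1)^i\omega(p_0,\dots,\overset{(o)}{p_i},\dots,p_m),$$ where $\overset{(o)}{p_i}$ means that $p_i$ is omitted; thus as a $k$-form at $p_0$, the $i=0$ term is the $k$-form $\omega(p_1,\dots,p_m)$ at $p_1$ transported to $p_0$ by $\widetilde{\varepsilon}(p_1,p_0)$. *)

(* Defs.v *)
From HB Require Import structures.
From mathcomp Require Import all_boot all_order all_algebra.
From mathcomp Require Import all_classical all_reals all_analysis.

Set Implicit Arguments.
Unset Strict Implicit.
Unset Printing Implicit Defensive.

Import Order.TTheory GRing.Theory Num.Theory.
Import numFieldNormedType.Exports.

Local Open Scope classical_set_scope.
Local Open Scope ring_scope.

(* C^r on an open set U: Frechet differentiable on U with all directional
   derivatives C^(r-1) on U.  Values of f outside U are irrelevant. *)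
Fixpoint Cr_on (R : realType) (V W : normedModType R) (r : nat)
    (U : set V) (f : V -> W) {struct r} : Prop :=
  if r is r'.+1 then
    (forall x, U x -> differentiable f x) /\
    (forall v : V, Cr_on r' U (fun x => 'D_v f x))
  else forall x, U x -> {for x, continuous f}.

Definition smooth_on (R : realType) (V W : normedModType R)
    (U : set V) (f : V -> W) : Prop :=
  forall r : nat, Cr_on r U f.

(* Coordinates of points are row vectors.  cinv is only meaningful on the
   image of the chart. *)
Record chart (R : realType) (n : nat) (T : topologicalType) := Chart {
  cdom : set T;
  cmap : T -> 'rV[R]_n;
  cinv : 'rV[R]_n -> T;
  cdom_open : open cdom;
  cimg_open : open (cmap @` cdom);
  cmapK : forall p, cdom p -> cinv (cmap p) = p;
  cmap_cont : forall p, cdom p -> {for p, continuous cmap};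
  cinv_cont : forall x, (cmap @` cdom) x -> {for x, continuous cinv}
}.

(* Connected smooth manifolds of dimension n.  chart_at is an arbitrary choice
   of a chart around each point; its only role is to present T_pM as R^n, a
   tangent vector at p being given by its components in the chart chart_at p. *)
Record manifold (R : realType) (n : nat) := Manifold {
  carrier :> topologicalType;
  mfd_hausdorff : hausdorff_space carrier;
  mfd_second_countable : @second_countable carrier;
  mfd_connected : connected [set: carrier];
  atlas : set (chart R n carrier);
  atlas_smooth : forall c c', atlas c -> atlas c' ->
    smooth_on (cmap c @` (cdom c `&` cdom c')) (cmap c' \o cinv c);
  chart_at : carrier -> chart R n carrier;
  chart_at_atlas : forall p, atlas (chart_at p);
  chart_at_dom : forall p, cdom (chart_at p) p
}.

Definition chart_around (R : realType) (n : nat) (M : manifold R n)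
    (c : chart R n M) (p : M) : Prop :=
  atlas c /\ cdom c p.

(* frame c p *m v is the column of components in the chart c of v : T_pM; the
   transpose is there because the library's 'J acts on row vectors.  The j-th
   column of invmx (frame c p) is the coordinate vector d/dx^j of c at p. *)
Definition frame (R : realType) (n : nat) (M : manifold R n)
    (c : chart R n M) (p : M) : 'M[R]_n :=
  ('J (cmap c \o cinv (chart_at p)) (cmap (chart_at p) p))^T.

Section MapsAndSplittings.
Variables (R : realType) (n : nat) (M : manifold R n).
Implicit Types (U : set M) (f : M -> M) (c : chart R n M) (p q : M).

Definition smooth_map_on U f : Prop :=
  (forall p, U p -> {for p, continuous f}) /\
  forall c c', atlas c -> atlas c' ->
    smooth_on (cmap c @` (cdom c `&` U `&` f @^-1` cdom c'))
              (cmap c' \o f \o cinv c).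

Definition diffeomorphism f : Prop :=
  exists g : M -> M, [/\ cancel f g, cancel g f,
    smooth_map_on setT f & smooth_map_on setT g].

(* The matrix (eps^i_j) of eps p q : T_pM -> T_qM in charts c at p, c' at q. *)
Definition eps_coord (eps : M -> M -> 'M[R]_n) c c' p q : 'M[R]_n :=
  frame c' q *m eps p q *m invmx (frame c p).

Definition eps_fun (eps : M -> M -> 'M[R]_n) c c'
    (z : 'rV[R]_n * 'rV[R]_n) : 'M[R]_n :=
  eps_coord eps c c' (cinv c z.1) (cinv c' z.2).

Record splitting := Splitting {
  eps :> M -> M -> 'M[R]_n;
  eps_unit : forall p q, eps p q \in unitmx;
  eps_comp : forall p q r, eps q r *m eps p q = eps p r;
  eps_inv : forall p q, eps q p = invmx (eps p q);
  eps_smooth : forall c c', atlas c -> atlas c' ->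
    smooth_on ((cmap c @` cdom c) `*` (cmap c' @` cdom c')) (eps_fun eps c c')
}.

(* d eps^a_r / dx^s + (d eps^a_r / dy^b) eps^b_s at (x, y) = (c p, c' q) *)
Definition eps_total_deriv (e : splitting) c c' p q (a r s : 'I_n) : R :=
  let z := (cmap c p, cmap c' q) in
  let E := fun z => eps_fun e c c' z a r in
  'D_(delta_mx 0 s, 0) E z +
  \sum_(b < n) 'D_(0, delta_mx 0 b) E z * eps_coord e c c' p q b s.

Definition local_Lie_group (e : splitting) : Prop :=
  forall p q c c', chart_around c p -> chart_around c' q ->
  forall a r s : 'I_n,
    eps_total_deriv e c c' p q a r s = eps_total_deriv e c c' p q a s r.

(* f solves d f^i / dx^j = eps^i_j (x, f x) on U. *)
Definition solution_on (e : splitting) U f : Prop :=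
  smooth_map_on U f /\
  forall p c c', U p -> chart_around c p -> chart_around c' (f p) ->
    ('J (cmap c' \o f \o cinv c) (cmap c p))^T = eps_coord e c c' p (f p).

(* Local solutions live on connected open sets (on a disconnected domain a
   solution may be glued from unrelated pieces). *)
Definition globalizable (e : splitting) : Prop :=
  forall U f, open U -> connected U -> U !=set0 -> solution_on e U f ->
  exists g : M -> M, [/\ diffeomorphism g, solution_on e setT g
                       & forall p, U p -> g p = f p].

End MapsAndSplittings.

Section Forms.
Variables (R : realType) (n : nat) (M : manifold R n).

(* A k-tuple of tangent vectors at a point is the n x k matrix with these
   vectors as columns; a k-covector is an alternating multilinear function of
   the columns (stated as determinant_multilinear, determinant_alternate). *)
Definition multilinear k (W : 'M[R]_(n, k) -> R) : Prop :=
  forall (j : 'I_k) (A B C : 'M[R]_(n, k)) (b c : R),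
    col j A = b *: col j B + c *: col j C ->
    col' j B = col' j A -> col' j C = col' j A ->
    W A = b * W B + c * W C.

Definition alternating k (W : 'M[R]_(n, k) -> R) : Prop :=
  forall (j1 j2 : 'I_k) (A : 'M[R]_(n, k)),
    j1 != j2 -> col j1 A = col j2 A -> W A = 0.

(* Assignments to (p_0, ..., p_m') of a function of k tangent vectors at p_0,
   with m = m'.+1 >= 1 points. *)
Definition pre_hform (m' k : nat) :=
  ('I_m'.+1 -> M) -> 'M[R]_(n, k) -> R.

(* omega_(i_1 ... i_k) in the chart c at the first point *)
Definition hcomp m' k (w : pre_hform m' k) (c : chart R n M)
    (I : {ffun 'I_k -> 'I_n}) (p : 'I_m'.+1 -> M) : R :=
  w p (invmx (frame c (p ord0)) *m \matrix_(i, j) (i == I j)%:R).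

(* The components as functions of the coordinates (x, y, ..., z), which are the
   rows of X. *)
Definition hcoord m' k (w : pre_hform m' k) (c : 'I_m'.+1 -> chart R n M)
    (I : {ffun 'I_k -> 'I_n}) (X : 'M[R]_(m'.+1, n)) : R :=
  hcomp w (c ord0) I (fun i => cinv (c i) (row i X)).

Record hform (m' k : nat) := HForm {
  hval :> pre_hform m' k;
  hform_multilinear : forall p, multilinear (hval p);
  hform_alternating : forall p, alternating (hval p);
  hform_smooth : forall c : 'I_m'.+1 -> chart R n M,
    (forall i, atlas (c i)) -> forall I,
    smooth_on [set X : 'M[R]_(m'.+1, n) |
                forall i, (cmap (c i) @` cdom (c i)) (row i X)]
              (hcoord hval c I)
}.

Variable e : splitting M.

(* D~_r F at (p_0, ..., p_m'), for a function F of the coordinates in the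
   charts c i around p i. *)
Definition Dtilde m' (c : 'I_m'.+1 -> chart R n M) (r : 'I_n)
    (F : 'M[R]_(m'.+1, n) -> R) (p : 'I_m'.+1 -> M) : R :=
  let X : 'M[R]_(m'.+1, n) := \matrix_(i < m'.+1) cmap (c i) (p i) in
  'D_(delta_mx ord0 r) F X +
  \sum_(i < m') \sum_(a < n)
    'D_(delta_mx (lift ord0 i) a) F X *
    eps_coord e (c ord0) (c (lift ord0 i)) (p ord0) (p (lift ord0 i)) a r.

(* (dx^(I 0) /\ ... /\ dx^(I (k-1))) evaluated on the columns of A *)
Definition wedge_dx k (I : 'I_k -> 'I_n) (A : 'M[R]_(n, k)) : R :=
  \det (\matrix_(a < k, b < k) A (I a) b).

Definition cons_index k (r : 'I_n) (I : 'I_k -> 'I_n) : 'I_k.+1 -> 'I_n :=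
  fun a => if unlift ord0 a is Some b then I b else r.

(* d~ omega, computed at (p_0, ..., p_m') in the coordinates of the charts
   c p_0, ..., c p_m'. *)
Definition dtilde (c : M -> chart R n M) m' k (w : pre_hform m' k) :
    pre_hform m' k.+1 :=
  fun p A =>
    (k`!)%:R^-1 * \sum_(r < n) \sum_(I : {ffun 'I_k -> 'I_n})
      Dtilde (c \o p) r (hcoord w (c \o p) I) p *
      wedge_dx (cons_index r I) (frame (c (p ord0)) (p ord0) *m A).

(* eps(p, q)_* alpha.  For alpha a k-covector at p, this is the value at q of
   the eps-invariant k-form whose value at p is alpha. *)
Definition push k (p q : M) (alpha : 'M[R]_(n, k) -> R) : 'M[R]_(n, k) -> R :=
  fun A => alpha (invmx (e p q) *m A).

(* The alternating sum of eps-invariant k-forms, evaluated at p_0: the i-th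
   form is given by its value at the first point of (p_0, ..., p_m) with p_i
   omitted, which is p_0 for i > 0 and p_1 for i = 0. *)
Definition delta m' k (w : pre_hform m' k) : pre_hform m'.+1 k :=
  fun p A =>
    \sum_(i < m'.+2) (-1) ^+ i *
      push (p (lift i ord0)) (p ord0) (w (p \o lift i)) A.

End Forms.

(* Main.v *)
Require Import Defs.
From mathcomp Require Import all_boot all_order perm all_algebra.
From mathcomp Require Import all_classical all_reals all_analysis.
From HB Require Import structures.

(* D~_r is the derivative along the vector field whose component at the i-th
   point is eps(p_0, p_i) d/dx^r.  Omitting p_i with i > 0 maps this field to
   the corresponding field on the remaining points, so these terms of delta
   commute with d~.  For i = 0 the components of the transported form are
   w_J(p_1, ...) eps^J_I(p_0, p_1).  By eps(p_1, p_i) eps(p_0, p_1) = eps(p_0, p_i)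
   the terms differentiating w_J assemble into the transport of d~ w.  The terms
   differentiating eps^J_I contain D~_r eps^a_s, which is symmetric in r and s by
   integrability, and vanish on antisymmetrization. *)

Set Implicit Arguments.
Unset Strict Implicit.
Unset Printing Implicit Defensive.

Import Order.TTheory GRing.Theory Num.Theory.
Import numFieldNormedType.Exports.

Local Open Scope classical_set_scope.
Local Open Scope ring_scope.

(** * Alternating forms *)

(** Used with [a] = 1/k!, [x] the wedge factors, [P] the i = 0 part of delta and [s l] the signs of
    the other parts: it splits d~ (delta w) into one antisymmetrized sum per omitted point. *)
Lemma sum_mul_split (R : comNzRingType) (I J K : finType) (a : R)
    (P x : I -> J -> R) (s : K -> R) (O : K -> I -> J -> R) :
  a * (\sum_i \sum_j (P i j + \sum_l s l * O l i j) * x i j) =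
  a * (\sum_i \sum_j P i j * x i j) +
  \sum_l s l * (a * \sum_i \sum_j O l i j * x i j).
Proof.
rewrite [X in _ = _ + X](eq_bigr (fun l =>
    a * \sum_i \sum_j s l * O l i j * x i j)) => [|l _]; last first.
  rewrite mulrCA mulr_sumr; congr (_ * _); apply: eq_bigr => i _.
  by rewrite mulr_sumr; apply: eq_bigr => j _; rewrite mulrA.
rewrite -mulr_sumr -mulrDr [X in a * (_ + X)]exchange_big -big_split; congr (_ * _).
apply: eq_bigr => i _ /=.
rewrite [X in _ = _ + X]exchange_big -big_split.
by apply: eq_bigr => j _ /=; rewrite mulrDl mulr_suml.
Qed.

Section Algebra.
Variables (R : realType) (n : nat).

Lemma cons_index0 k (r : 'I_n) (I : 'I_k -> 'I_n) : cons_index r I ord0 = r.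
Proof. by rewrite /cons_index unlift_none. Qed.

Lemma cons_indexS k (r : 'I_n) (I : 'I_k -> 'I_n) j :
  cons_index r I (lift ord0 j) = I j.
Proof. by rewrite /cons_index liftK. Qed.

(** A pair (r, I) is a multi-index of length k + 1 cut after its first entry. On the joint sum,
    permutations of all k + 1 positions act. *)
Lemma sum_cons_index k (F : ('I_k.+1 -> 'I_n) -> R) :
  \sum_(r < n) \sum_(I : {ffun 'I_k -> 'I_n}) F (cons_index r I) =
  \sum_(f : {ffun 'I_k.+1 -> 'I_n}) F f.
Proof.
rewrite pair_big /= [RHS](reindex
  (fun x : 'I_n * {ffun 'I_k -> 'I_n} => [ffun j => cons_index x.1 x.2 j])) /=.
  apply: eq_bigr => -[r I] _; congr F; apply/funext => j; by rewrite ffunE.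
exists (fun f : {ffun 'I_k.+1 -> 'I_n} =>
  (f ord0, [ffun j => f (lift ord0 j)])) => [[r I]|f] _ /=.
  rewrite ffunE cons_index0; congr (_, _).
  by apply/ffunP => j; rewrite !ffunE cons_indexS.
apply/ffunP => j; rewrite ffunE.
by case: (unliftP ord0 j) => [j'|] ->; rewrite ?cons_indexS ?cons_index0 ?ffunE.
Qed.

(** The matrix inside [hcomp], named so that values of a form on it are its components. *)
Definition unit_cols k (I : 'I_k -> 'I_n) : 'M[R]_(n, k) :=
  \matrix_(i, j) (i == I j)%:R.

(** Induction on the number of columns: with the first column fixed, the map is multilinear in the
    others; the first column is then expanded in the standard basis. *)
Lemma multilinear_sum_unit_cols k (W : 'M[R]_(n, k) -> R) (B : 'M[R]_(n, k)) :
  multilinear W ->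
  W B = \sum_(J : {ffun 'I_k -> 'I_n}) (\prod_j B (J j) j) * W (unit_cols J).
Proof.
elim: k W B => [|k IH] W B Wlin.
  rewrite (big_pred1 (ffun0 (card_ord 0) : {ffun 'I_0 -> 'I_n})).
    by rewrite big_ord0 mul1r; congr W; apply/matrixP => i [].
  by move=> J; apply/esym/eqP/ffunP => -[].
pose glue (v : 'cV[R]_n) (X : 'M[R]_(n, k)) : 'M[R]_(n, k.+1) :=
  \matrix_(i, j) (if unlift ord0 j is Some j' then X i j' else v i ord0).
have glue0 v X i : glue v X i ord0 = v i ord0 by rewrite mxE unlift_none.
have glueS v X i j : glue v X i (lift ord0 j) = X i j by rewrite mxE liftK.
have BE : B = glue (col ord0 B) (col' ord0 B).
  apply/matrixP => i j; rewrite mxE.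
  by case: unliftP => [j'|] ->; rewrite !mxE.
have lin0 X : linear_for *%R (fun v => W (glue v X)).
  move=> a u v /=; rewrite -[W (glue v X)]mul1r; apply: (Wlin ord0).
  - by apply/matrixP => i j; rewrite !mxE unlift_none mul1r.
  - by apply/matrixP => i j; rewrite !mxE liftK.
  - by apply/matrixP => i j; rewrite !mxE liftK.
have linS v : multilinear (fun X => W (glue v X)).
  move=> j X Y Z b c ejj eY eZ.
  have col'S (T : 'M[R]_(n, k)) : col' j T = col' j X ->
      col' (lift ord0 j) (glue v T) = col' (lift ord0 j) (glue v X).
    move=> /matrixP eT; apply/matrixP => i j'; rewrite !mxE.
    case: unliftP => [l|] // ljl.
    (* Column [lift ord0 j] of the glued matrix is column j of its second part, so no column left
       after its removal comes from column j. *)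
    have: l != j by apply/eqP => lj; move: (neq_lift (lift ord0 j) j');
      rewrite ljl lj eqxx.
    case: (unliftP j l) => [l' -> _|->]; last by rewrite eqxx.
    by move: (eT i l'); rewrite !mxE.
  apply: (Wlin (lift ord0 j)); [|exact: col'S|exact: col'S].
  apply/matrixP => i j'; rewrite !mxE !liftK.
  by move/matrixP: ejj => /(_ i ord0); rewrite !mxE.
rewrite {1}BE (IH _ _ (linS _)).
pose G (f : 'I_k.+1 -> 'I_n) : R := (\prod_j B (f j) j) * W (unit_cols f).
rewrite -[RHS](sum_cons_index G) exchange_big /=; apply: eq_bigr => J _.
have vE (v : 'cV[R]_n) : v = \sum_(r < n) v r ord0 *: delta_mx r ord0.
  apply/matrixP => i j; rewrite summxE (bigD1 i) //= big1 => [|l li].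
    by rewrite !mxE !eqxx ord1 mulr1 addr0.
  by rewrite !mxE eq_sym (negPf li) mulr0.
have Wsum v X : W (glue v X) = \sum_(r < n) v r ord0 * W (glue (delta_mx r ord0) X).
  pose L : {scalar 'cV[R]_n} :=
    HB.pack (fun v => W (glue v X))
      (GRing.isLinear.Build _ _ _ _ (fun v => W (glue v X)) (lin0 X)).
  rewrite -[LHS]/(L v) {1}(vE v) linear_sum.
  by apply: eq_bigr => r _; exact: linearZ.
rewrite Wsum big_distrr /=; apply: eq_bigr => r _.
rewrite /G big_ord_recl cons_index0 mxE mulrCA mulrA; congr (_ * _ * W _).
  by apply: eq_bigr => j _; rewrite cons_indexS mxE.
apply/matrixP => i j; rewrite !mxE /cons_index.
by case: unliftP => [j'|] _; rewrite ?mxE ?andbT.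
Qed.

Lemma mulmx_unit_cols k (B : 'M[R]_n) (I : 'I_k -> 'I_n) i j :
  (B *m unit_cols I) i j = B i (I j).
Proof.
rewrite mxE (bigD1 (I j)) //= big1 => [|l lj].
  by rewrite mxE eqxx mulr1 addr0.
by rewrite mxE (negPf lj) mulr0.
Qed.

Lemma multilinear_mulmx k (W : 'M[R]_(n, k) -> R) (P : 'M[R]_n) :
  multilinear W -> multilinear (fun B => W (P *m B)).
Proof.
move=> Wlin j B B1 B2 b c ej e1 e2.
have col'W (C : 'M[R]_(n, k)) : col' j C = col' j B ->
    col' j (P *m C) = col' j (P *m B).
  move=> /matrixP eB; apply/matrixP => i l; rewrite !mxE.
  by apply: eq_bigr => a _; move: (eB a l); rewrite !mxE => ->.
apply: (Wlin j); [|exact: col'W|exact: col'W].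
by rewrite !colE -!mulmxA -!colE ej mulmxDr !scalemxAr.
Qed.

(** The determinant of [B^T *m A] is multilinear in the columns of B. Taking as columns the rows of
    E selected by f and expanding them in unit columns gives the pullback rule for dx^f. *)
Lemma wedge_dx_mulmx k (f : 'I_k -> 'I_n) (E : 'M[R]_n) (A : 'M[R]_(n, k)) :
  wedge_dx f (E *m A) =
  \sum_(g : {ffun 'I_k -> 'I_n}) (\prod_a E (f a) (g a)) * wedge_dx g A.
Proof.
pose W (B : 'M[R]_(n, k)) := \det (B^T *m A).
have Wlin : multilinear W.
  move=> j B B1 B2 b c ej e1 e2; rewrite /W.
  have row'W (C : 'M[R]_(n, k)) : col' j C = col' j B ->
      row' j (B^T *m A) = row' j (C^T *m A).
    move=> /matrixP eB; apply/matrixP => a l; rewrite !mxE.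
    by apply: eq_bigr => i _; move: (eB i a); rewrite !mxE => ->.
  apply: (determinant_multilinear (i0 := j)).
  - rewrite !row_mul -!tr_col ej linearD !linearZ /= mulmxDl !scalemxAl.
    by rewrite -!scalemxAl.
  - exact/esym/row'W.
  - exact/esym/row'W.
transitivity (W (\matrix_(i, a) E (f a) i)).
  congr (\det _); apply/matrixP => a b; rewrite !mxE.
  by apply: eq_bigr => l _; rewrite !mxE.
rewrite (multilinear_sum_unit_cols _ Wlin); apply: eq_bigr => g _.
congr (_ * _); first by apply: eq_bigr => a _; rewrite mxE.
congr (\det _); apply/matrixP => a b; rewrite !mxE (bigD1 (g a)) //= !mxE eqxx.
rewrite mul1r big1 ?addr0 // => l lg; by rewrite !mxE (negPf lg) mul0r.
Qed.

(* Exchanging dx^r with dx^(I j) flips the sign of the wedge product. *)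
Lemma sum_sym_wedge k (j : 'I_k) (G : ('I_k.+1 -> 'I_n) -> R)
    (A : 'M[R]_(n, k.+1)) :
  (forall f, G (f \o tperm ord0 (lift ord0 j)) = G f) ->
  \sum_(r < n) \sum_(I : {ffun 'I_k -> 'I_n})
    G (cons_index r I) * wedge_dx (cons_index r I) A = 0.
Proof.
set s := tperm _ _ => Gsym.
rewrite (sum_cons_index (fun f => G f * wedge_dx f A)); set S := \sum_(f : _) _.
suff : S = - S by move/eqP; rewrite -addr_eq0 -mulr2n mulrn_eq0 /= => /eqP.
rewrite /S {1}(reindex_inj (h := fun f : {ffun 'I_k.+1 -> 'I_n} =>
  [ffun a => f (s a)])) /=; last first.
  move=> f g /ffunP fg; apply/ffunP => a.
  by move: (fg (s a)); rewrite !ffunE tpermK.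
rewrite -sumrN; apply: eq_bigr => f _.
rewrite (_ : ([ffun a => f (s a)] : _ -> _) = f \o s); last first.
  by apply/funext => a; rewrite ffunE.
rewrite Gsym -mulrN; congr (_ * _); rewrite /wedge_dx.
rewrite (_ : (\matrix_(a, b) A ((f \o s) a) b) =
  row_perm s (\matrix_(a, b) A (f a) b)); last first.
  by apply/matrixP => a b; rewrite !mxE.
by rewrite row_permE det_mulmx det_perm odd_tperm neq_lift expr1 mulN1r.
Qed.

(** Here E stands for eps(p_0, p_1), [D b J] for D~_b w_J at (p_1, ..., p_m) and [S a s r] for D~_r
    eps^a_s. Symmetry of S kills the terms in [w J]; the others form a pullback by E. *)
Lemma wedge_pullback k (E : 'M[R]_n) (D : 'I_n -> {ffun 'I_k -> 'I_n} -> R)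
    (w : {ffun 'I_k -> 'I_n} -> R) (S : 'I_n -> 'I_n -> 'I_n -> R)
    (A : 'M[R]_(n, k.+1)) :
  (forall a r s, S a r s = S a s r) ->
  \sum_(r < n) \sum_(I : {ffun 'I_k -> 'I_n})
    (\sum_(J : {ffun 'I_k -> 'I_n})
      ((\sum_(b < n) E b r * D b J) * (\prod_j E (J j) (I j)) +
       w J * \sum_j \prod_i
         (if i == j then S (J i) (I i) r else E (J i) (I i)))) *
    wedge_dx (cons_index r I) A =
  \sum_(b < n) \sum_(J : {ffun 'I_k -> 'I_n})
    D b J * wedge_dx (cons_index b J) (E *m A).
Proof.
move=> Ssym.
transitivity (\sum_(r < n) \sum_(I : {ffun 'I_k -> 'I_n})
  \sum_(J : {ffun 'I_k -> 'I_n}) \sum_(b < n) D b J *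
  ((\prod_a E (cons_index b J a) (cons_index r I a)) *
   wedge_dx (cons_index r I) A)).
  (* The terms in D cancel in the difference, leaving the terms in S; these vanish separately for
     each J and each differentiated factor j. *)
  apply/eqP; rewrite -subr_eq0 -sumrB.
  rewrite (eq_bigr (fun r => \sum_(J : {ffun 'I_k -> 'I_n}) \sum_(j < k)
    \sum_(I : {ffun 'I_k -> 'I_n}) (w J * \prod_i
         (if i == j then S (J i) (I i) r else E (J i) (I i))) *
    wedge_dx (cons_index r I) A)); last first.
    move=> r _; rewrite -sumrB.
    rewrite (eq_bigr (fun I : {ffun 'I_k -> 'I_n} =>
      \sum_(J : {ffun 'I_k -> 'I_n}) \sum_(j < k) (w J * \prod_i
         (if i == j then S (J i) (I i) r else E (J i) (I i))) *
       wedge_dx (cons_index r I) A)); last first.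
      move=> I _; rewrite big_distrl -sumrB; apply: eq_bigr => J _ /=.
      rewrite mulrDl addrAC [X in X + _](_ : _ = 0) ?add0r.
        by rewrite [w J * _]mulr_sumr mulr_suml.
      apply/eqP; rewrite subr_eq0; apply/eqP.
      rewrite !big_distrl /=; apply: eq_bigr => b _.
      rewrite big_ord_recl !cons_index0.
      under [in RHS]eq_bigr do rewrite !cons_indexS.
      by rewrite [E b r * _]mulrC !mulrA.
    by rewrite exchange_big; apply: eq_bigr => J _; rewrite exchange_big.
  rewrite exchange_big big1 // => J _; rewrite exchange_big big1 // => j _.
  (* The coefficient as a function of the joint multi-index: exchanging positions 0 and j + 1
     exchanges r with I j, the last two arguments of S. *)
  pose G (f : 'I_k.+1 -> 'I_n) := w J * \prod_i
    (if i == j then S (J i) (f (lift ord0 i)) (f ord0)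
     else E (J i) (f (lift ord0 i))).
  rewrite -[RHS](@sum_sym_wedge k j G A) => [|f].
    apply: eq_bigr => r _; apply: eq_bigr => I _; congr (_ * _ * _).
    by apply: eq_bigr => i _; rewrite !cons_indexS cons_index0.
  congr (_ * _); apply: eq_bigr => i _ /=; rewrite tpermL.
  case: eqP => [->|/eqP ij]; first by rewrite tpermR Ssym.
  by rewrite tpermD // (inj_eq lift_inj) eq_sym.
(* Once b and J are outermost, the sum over (r, I) is the expansion of the pullback of dx^b /\ dx^J
   by E. *)
rewrite (eq_bigr (fun r => \sum_(b < n) \sum_(J : {ffun 'I_k -> 'I_n})
  \sum_(I : {ffun 'I_k -> 'I_n}) D b J *
  ((\prod_a E (cons_index b J a) (cons_index r I a)) *
   wedge_dx (cons_index r I) A))); last first.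
  move=> r _; rewrite exchange_big /= [RHS]exchange_big /=.
  by apply: eq_bigr => J _; rewrite exchange_big.
rewrite exchange_big /=; apply: eq_bigr => b _.
rewrite exchange_big /=; apply: eq_bigr => J _.
rewrite wedge_dx_mulmx -(sum_cons_index (fun f =>
  (\prod_a E (cons_index b J a) (f a)) * wedge_dx f A)).
rewrite big_distrr; apply: eq_bigr => r _.
by rewrite big_distrr.
Qed.

(** This lemma and the next cancel or insert frames around B = eps(p_0, p_1), passing between the
    matrix of eps in charts and its matrix in the reference frames. *)
Lemma conj_mulKmx k (F B G : 'M[R]_n) (A : 'M[R]_(n, k)) :
  F \in unitmx -> invmx F *m (F *m B *m G *m A) = B *m (G *m A).
Proof. by move=> Fu; rewrite -!mulmxA mulKmx. Qed.

Lemma conj_mulmx k (F B G : 'M[R]_n) (A : 'M[R]_(n, k)) :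
  G \in unitmx -> F *m (B *m A) = F *m B *m invmx G *m (G *m A).
Proof. by move=> Gu; rewrite -!mulmxA mulKmx. Qed.

End Algebra.

(** * Calculus *)

Section Calculus.
Variables (R : realType) (U V W : normedModType R).

(** The two difference quotients agree for every increment, since L(h v + x) = h L v + L x. *)
Lemma derive_comp_linear (L : U -> V) (F : V -> W) x v :
  linear L -> 'D_v (F \o L) x = 'D_(L v) F (L x).
Proof.
by move=> Llin; rewrite /derive; under eq_fun do rewrite /= Llin.
Qed.

Lemma derive_addv (F : V -> W) x u v : differentiable F x ->
  'D_(u + v) F x = 'D_u F x + 'D_v F x.
Proof. by move=> dF; rewrite !deriveE // linearD. Qed.

Lemma derive_sumv (F : V -> W) x (I : finType) (a : I -> R) (v : I -> V) :
  differentiable F x ->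
  'D_(\sum_i a i *: v i) F x = \sum_i a i *: 'D_(v i) F x.
Proof.
move=> dF; rewrite deriveE // linear_sum; apply: eq_bigr => i _.
by rewrite linearZ deriveE.
Qed.

Lemma differentiable_bigsum (I : Type) (r : seq I) (F : I -> V -> W) x :
  (forall i, differentiable (F i) x) ->
  differentiable (fun y => \sum_(i <- r) F i y) x.
Proof.
move=> dF; elim: r => [|i r IH].
  by under eq_fun do rewrite big_nil; exact: differentiable_cst.
by under eq_fun do rewrite big_cons; exact: differentiableD.
Qed.

Lemma derive_bigsum (I : Type) (r : seq I) (F : I -> V -> W) x v :
  (forall i, differentiable (F i) x) ->
  'D_v (fun y => \sum_(i <- r) F i y) x = \sum_(i <- r) 'D_v (F i) x.
Proof.
move=> dF; elim: r => [|i r IH].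
  by under eq_fun do rewrite big_nil; rewrite big_nil derive_cst.
under eq_fun do rewrite big_cons; rewrite big_cons -IH.
apply: deriveD; apply: diff_derivable => //.
exact: differentiable_bigsum.
Qed.

End Calculus.

Section Products.
Variables (R : realType) (V : normedModType R).

Lemma differentiable_bigprod (I : Type) (r : seq I) (F : I -> V -> R) x :
  (forall i, differentiable (F i) x) ->
  differentiable (fun y => \prod_(i <- r) F i y) x.
Proof.
move=> dF; elim: r => [|i r IH].
  by under eq_fun do rewrite big_nil; exact: differentiable_cst.
by under eq_fun do rewrite big_cons; exact: differentiableM.
Qed.

Lemma derive_mul (f g : V -> R) x v : differentiable f x -> differentiable g x ->
  'D_v (fun y => f y * g y) x = 'D_v f x * g x + f x * 'D_v g x.
Proof.
move=> df dg; rewrite [LHS]deriveM; try exact: diff_derivable.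
by rewrite addrC; congr (_ + _); exact: mulrC.
Qed.

Lemma derive_prod k (F : 'I_k -> V -> R) x v :
  (forall i, differentiable (F i) x) ->
  'D_v (fun y => \prod_i F i y) x =
  \sum_j \prod_i (if i == j then 'D_v (F i) x else F i x).
Proof.
elim: k F => [|k IH] F dF.
  by under eq_fun do rewrite big_ord0; rewrite big_ord0 derive_cst.
under eq_fun do rewrite big_ord_recl.
rewrite derive_mul //; last exact: differentiable_bigprod.
rewrite IH // [RHS]big_ord_recl big_ord_recl eqxx; congr (_ + _).
rewrite big_distrr; apply: eq_bigr => j _ /=; rewrite big_ord_recl /=.
by congr (_ * _); apply: eq_bigr => i _; rewrite (inj_eq lift_inj).
Qed.

End Products.

Section Rowsub.
Variables (R : realType) (n : nat).

Lemma rowsub_linear m1 m2 (f : 'I_m2 -> 'I_m1) :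
  linear (rowsub f : 'M[R]_(m1, n) -> 'M[R]_(m2, n)).
Proof. by move=> a u v; rewrite linearP. Qed.

(** Balls of matrices are defined entrywise and every entry of the selection is an entry of X, so
    the same radius works. *)
Lemma continuous_rowsub m1 m2 (f : 'I_m2 -> 'I_m1) :
  continuous (rowsub f : 'M[R]_(m1, n) -> 'M[R]_(m2, n)).
Proof.
move=> X B /nbhs_ballP[eps eps0 sub]; apply/nbhs_ballP; exists eps => //= Y XY.
by apply: sub; case: XY => _ XY; split => // i j; rewrite !mxE; exact: XY.
Qed.

Lemma differentiable_rowsub m1 m2 (f : 'I_m2 -> 'I_m1) X :
  differentiable (rowsub f : 'M[R]_(m1, n) -> 'M[R]_(m2, n)) X.
Proof. by apply: linear_differentiable; exact: continuous_rowsub. Qed.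

Lemma continuous_row m (i : 'I_m) :
  continuous (row i : 'M[R]_(m, n) -> 'rV[R]_n).
Proof.
rewrite (_ : row i = rowsub (fun=> i)); first exact: continuous_rowsub.
by apply/funext => X; rewrite rowEsub.
Qed.

Lemma differentiable_row m (i : 'I_m) X :
  differentiable (row i : 'M[R]_(m, n) -> 'rV[R]_n) X.
Proof. by apply: linear_differentiable; exact: continuous_row. Qed.

End Rowsub.

(** * Coordinate changes and frames *)

Section Frames.
Variables (R : realType) (n : nat) (M : manifold R n).

(** Chain rule for the composite of the two transition maps. Jacobians act on row vectors from the
    right, so the map applied first stands on the left. *)
Lemma transition_jacobianK (c c' : chart R n M) p :
  chart_around c p -> chart_around c' p ->
  'J (cmap c \o cinv c') (cmap c' p) *m 'J (cmap c' \o cinv c) (cmap c p) = 1%:M.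
Proof.
move=> [ac cp] [ac' cp'].
have df : differentiable (cmap c \o cinv c') (cmap c' p).
  by apply: (atlas_smooth ac' ac 1).1; exists p.
have dg : differentiable (cmap c' \o cinv c) (cmap c p).
  by apply: (atlas_smooth ac ac' 1).1; exists p.
have fp : (cmap c \o cinv c') (cmap c' p) = cmap c p by rewrite /= cmapK.
apply/row_matrixP => i; rewrite row_mul row1 !rowE.
rewrite -fp in dg *; rewrite -!deriveEjacobian //.
rewrite (deriveE _ dg) (deriveE _ df).
rewrite -[LHS]/(('d (cmap c' \o cinv c) ((cmap c \o cinv c') (cmap c' p)) \o
  'd (cmap c \o cinv c') (cmap c' p)) (delta_mx 0 i)).
rewrite -diff_comp // -deriveE; last exact: differentiable_comp.
(* The composite is the identity only near [cmap c' p], where x lies in the image of c' and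
   [cinv c' x] in the domain of c. *)
rewrite (@near_eq_derive _ _ _ _ id) ?derive_id //.
have U' : nbhs (cmap c' p) (cmap c' @` cdom c').
  by apply: open_nbhs_nbhs; split; [exact: cimg_open | exists p].
have U : nbhs (cmap c' p) (cinv c' @^-1` cdom c).
  apply: (@cinv_cont _ _ _ c'); first by exists p.
  by rewrite cmapK //; apply: open_nbhs_nbhs; split => //; exact: cdom_open.
near=> x.
have [q q' xq] : (cmap c' @` cdom c') x by near: x.
have : cdom c (cinv c' x) by near: x.
by rewrite -xq /= cmapK // => qc; rewrite cmapK.
Unshelve. all: by end_near. Qed.

Lemma frame_unit (c : chart R n M) p :
  chart_around c p -> frame c p \in unitmx.
Proof.
move=> cp; rewrite /frame unitmx_tr.
have /mulmx1_unit[] // := transition_jacobianK (conj (chart_at_atlas p) (chart_at_dom p)) cp.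
Qed.

End Frames.

(** * Horizontal forms *)

Section HorizontalForms.
Variables (R : realType) (n : nat) (M : manifold R n) (e : splitting M).

(** By the composition rule eps(p, p) is idempotent, and it is invertible. *)
Lemma eps_refl p : e p p = 1%:M.
Proof. by rewrite -[LHS](mulKmx (eps_unit e p p)) eps_comp mulVmx ?eps_unit. Qed.

Lemma push_refl k p (alpha : 'M[R]_(n, k) -> R) A : push e p p alpha A = alpha A.
Proof. by rewrite /push eps_refl invmx1 mul1mx. Qed.

Lemma eps_coord_comp c c' c'' p q r : chart_around c' q ->
  eps_coord e c' c'' q r *m eps_coord e c c' p q = eps_coord e c c'' p r.
Proof.
move=> /frame_unit c'q; rewrite /eps_coord !mulmxA mulmxKV //.
by rewrite -(mulmxA _ (e q r)) eps_comp.
Qed.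

Lemma eps_coord_refl c p : chart_around c p -> eps_coord e c c p p = 1%:M.
Proof. by move=> /frame_unit cp; rewrite /eps_coord eps_refl mulmx1 mulmxV. Qed.

Lemma eps_funE c c' p q : chart_around c p -> chart_around c' q ->
  eps_fun e c c' (cmap c p, cmap c' q) = eps_coord e c c' p q.
Proof. by move=> [_ cp] [_ c'q]; rewrite /eps_fun /= !cmapK. Qed.

Lemma eps_fun_differentiable c c' p q a r :
  chart_around c p -> chart_around c' q ->
  differentiable (fun z => eps_fun e c c' z a r) (cmap c p, cmap c' q).
Proof.
move=> [ac cp] [ac' c'q].
apply: (@differentiable_comp _ _ _ _ (eps_fun e c c') (fun N : 'M[R]_n => N a r)).
  by apply: (eps_smooth e ac ac' 1).1; split; [exists p|exists q].
exact: differentiable_coord.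
Qed.

Definition coord_mx m (c : 'I_m -> chart R n M) (p : 'I_m -> M) : 'M[R]_(m, n) :=
  \matrix_(i < m) cmap (c i) (p i).

(* The vector along which Dtilde e c r differentiates; since eps(p_0, p_0) = 1,
   the first row needs no separate treatment. *)
Definition hlift m (c : 'I_m.+1 -> chart R n M) (p : 'I_m.+1 -> M) (r : 'I_n) :
    'M[R]_(m.+1, n) :=
  \matrix_(i, a) eps_coord e (c ord0) (c i) (p ord0) (p i) a r.

Lemma rowsub_coord_mx m1 m2 (f : 'I_m2 -> 'I_m1) c p :
  rowsub f (coord_mx c p) = coord_mx (c \o f) (p \o f).
Proof. by apply/matrixP => i j; rewrite !mxE. Qed.

(** Row i is eps(p_(f 0), p_(f i)) eps(p_0, p_(f 0)) = eps(p_0, p_(f i)). For [f = lift ord0] this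
    turns D~_r into a combination of the D~_b based at p_1. *)
Lemma rowsub_hlift m1 m2 (f : 'I_m2.+1 -> 'I_m1.+1) c p r :
  chart_around (c (f ord0)) (p (f ord0)) ->
  rowsub f (hlift c p r) =
  \sum_(b < n) eps_coord e (c ord0) (c (f ord0)) (p ord0) (p (f ord0)) b r *:
    hlift (c \o f) (p \o f) b.
Proof.
move=> cf; apply/matrixP => i a.
rewrite summxE 2!mxE -(eps_coord_comp _ _ _ _ cf) mxE; apply: eq_bigr => b _.
by rewrite [RHS]mxE [hlift _ _ _ _ _]mxE mulrC.
Qed.

Lemma rowsub_hlift0 m1 m2 (f : 'I_m2.+1 -> 'I_m1.+1) c p r :
  f ord0 = ord0 -> rowsub f (hlift c p r) = hlift (c \o f) (p \o f) r.
Proof. by move=> f0; apply/matrixP => i a; rewrite !mxE /= f0. Qed.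

Section Charts.
Variables (m' : nat) (c : 'I_m'.+1 -> chart R n M) (p : 'I_m'.+1 -> M).
Hypothesis cp : forall i, chart_around (c i) (p i).

(** Expand [hlift] in matrix units and use linearity of the differential; row 0 contributes only the
    unit vector r. *)
Lemma DtildeE r (F : 'M[R]_(m'.+1, n) -> R) :
  differentiable F (coord_mx c p) ->
  Dtilde e c r F p = 'D_(hlift c p r) F (coord_mx c p).
Proof.
move=> dF; rewrite /Dtilde -/(coord_mx c p).
rewrite (_ : hlift c p r = delta_mx ord0 r + \sum_(i < m') \sum_(a < n)
  eps_coord e (c ord0) (c (lift ord0 i)) (p ord0) (p (lift ord0 i)) a r *:
    delta_mx (lift ord0 i) a); last first.
  rewrite [LHS]matrix_sum_delta big_ord_recl; congr (_ + _).
    rewrite (bigD1 r) //= big1 ?addr0 => [|a ar].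
      by rewrite mxE eps_coord_refl // mxE eqxx scale1r.
    by rewrite mxE eps_coord_refl // mxE (negPf ar) scale0r.
  by apply: eq_bigr => i _; apply: eq_bigr => a _; rewrite mxE.
rewrite [RHS]deriveE // linearD linear_sum !deriveE //; congr (_ + _).
apply: eq_bigr => i _; rewrite linear_sum; apply: eq_bigr => a _.
by rewrite linearZ deriveE // mulrC.
Qed.

(** Needed because the coordinate formula for delta w holds only where the rows of X lie in the
    chart images. *)
Lemma Dtilde_near r (F G : 'M[R]_(m'.+1, n) -> R) :
  (\forall X \near coord_mx c p, F X = G X) ->
  Dtilde e c r F p = Dtilde e c r G p.
Proof.
move=> FG; rewrite /Dtilde -/(coord_mx c p) (near_eq_derive _ FG).
congr (_ + _); apply: eq_bigr => i _; apply: eq_bigr => a _.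
by rewrite (near_eq_derive _ FG).
Qed.

Lemma coord_mx_near : \forall X \near coord_mx c p,
  forall i, (cmap (c i) @` cdom (c i)) (row i X).
Proof.
apply: (@filter_forall _ _
  (fun i X => (cmap (c i) @` cdom (c i)) (row i X)) _ (nbhs_filter _)) => i.
have : nbhs (row i (coord_mx c p)) (cmap (c i) @` cdom (c i)).
  rewrite rowK; apply: open_nbhs_nbhs; split; first exact: cimg_open.
  by exists (p i) => //; exact: (cp i).2.
exact: continuous_row.
Qed.

Lemma hcoord_differentiable k (w : hform M m' k) I :
  differentiable (hcoord w c I) (coord_mx c p).
Proof.
apply: (hform_smooth w (fun i => (cp i).1) I 1).1 => i.
by rewrite rowK; exists (p i) => //; exact: (cp i).2.
Qed.

End Charts.

(** Omitting a point other than p_0 leaves p_0 in first place, so the transport in that term of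
    delta is trivial. *)
Lemma lift_liftS m (i : 'I_m.+1) : lift (lift ord0 i) ord0 = ord0 :> 'I_m.+2.
Proof. exact: val_inj. Qed.

(** * Components of delta w and their derivatives *)

Section Delta.
Variables (m' k : nat) (w : hform M m' k).
Variables (c : 'I_m'.+2 -> chart R n M).
Let ord1 : 'I_m'.+2 := lift ord0 ord0.

Definition eps01 (a r : 'I_n) (X : 'M[R]_(m'.+2, n)) : R :=
  eps_fun e (c ord0) (c ord1) (row ord0 X, row ord1 X) a r.

(** The components w_J(y, ..., z) eps^J_I(x, y) of the i = 0 term of delta, with J running over all
    multi-indices. *)
Definition hcoord_push (I : {ffun 'I_k -> 'I_n}) (X : 'M[R]_(m'.+2, n)) : R :=
  \sum_(J : {ffun 'I_k -> 'I_n})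
    hcoord w (c \o lift ord0) J (rowsub (lift ord0) X) *
    \prod_j eps01 (J j) (I j) X.

Definition hcoord_omit (i : 'I_m'.+1) (I : {ffun 'I_k -> 'I_n})
    (X : 'M[R]_(m'.+2, n)) : R :=
  hcoord w (c \o lift (lift ord0 i)) I (rowsub (lift (lift ord0 i)) X).

Lemma hcoord_rowsub (f : 'I_m'.+1 -> 'I_m'.+2) I X :
  let q i := cinv (c i) (row i X) in
  hcoord w (c \o f) I (rowsub f X) =
  hval w (q \o f) (invmx (frame (c (f ord0)) (q (f ord0))) *m unit_cols R I).
Proof.
move=> q; rewrite /hcoord; set q' := fun i => _.
suff -> : q' = q \o f by [].
apply/funext => i; rewrite /q' /q /=; congr (cinv _ _).
by apply/matrixP => a b; rewrite !mxE.
Qed.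

Lemma push_lift0 (f : 'I_m'.+1 -> 'I_m'.+2) l q (alpha : 'M[R]_(n, l) -> R) A :
  f ord0 = ord0 -> push e (q (f ord0)) (q ord0) alpha A = alpha A.
Proof. by move=> ->; exact: push_refl. Qed.

Hypothesis ac : forall i, atlas (c i).

(** For i = 0, w is evaluated at p_1 on the images under eps(p_0, p_1) of the coordinate vectors at
    p_0; multilinear expansion in the coordinate vectors at p_1 gives [hcoord_push]. *)
Lemma hcoord_delta I X : (forall i, (cmap (c i) @` cdom (c i)) (row i X)) ->
  hcoord (delta e w) c I X =
  hcoord_push I X +
  \sum_(i < m'.+1) (-1) ^+ lift ord0 i * hcoord_omit i I X.
Proof.
move=> XU; rewrite {1}/hcoord; set q := fun i => _.
rewrite /hcomp /delta big_ord_recl expr0 mul1r.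
congr (_ + _); last first.
  apply: eq_bigr => i _; congr (_ * _).
  rewrite (push_lift0 q _ _ (lift_liftS i)).
  by rewrite /hcoord_omit hcoord_rowsub lift_liftS.
rewrite /push -eps_inv -/ord1.
pose P := invmx (frame (c ord1) (q ord1)).
(* [XU] places this point in the chart domain, which makes the frame there invertible. *)
have c1 : chart_around (c ord1) (q ord1).
  split => //; rewrite /q; have [x cx <-] := XU ord1.
  by rewrite cmapK.
rewrite (_ : _ *m _ = P *m (eps_coord e (c ord0) (c ord1) (q ord0) (q ord1) *m
  unit_cols R I)); last first.
  exact/esym/(@conj_mulKmx _ _ _ (frame (c ord1) (q ord1)) (e (q ord0) (q ord1))
    (invmx (frame (c ord0) (q ord0))) (unit_cols R I))/frame_unit.
rewrite (multilinear_sum_unit_cols _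
  (multilinear_mulmx P (@hform_multilinear _ _ _ _ _ w (q \o lift ord0)))).
rewrite /hcoord_push; apply: eq_bigr => J _; rewrite hcoord_rowsub [RHS]mulrC.
by under eq_bigr do rewrite mulmx_unit_cols.
Qed.

Variable p : 'I_m'.+2 -> M.
Hypothesis cp : forall i, chart_around (c i) (p i).

Let X0 := coord_mx c p.
Let E := eps_coord e (c ord0) (c ord1) (p ord0) (p ord1).
Let row01 (X : 'M[R]_(m'.+2, n)) := (row ord0 X, row ord1 X).

Lemma row01_coord_mx : row01 X0 = (cmap (c ord0) (p ord0), cmap (c ord1) (p ord1)).
Proof. by rewrite /row01 /X0 !rowK. Qed.

Lemma eps01_coord_mx a r : eps01 a r X0 = E a r.
Proof. by rewrite /eps01 -/(row01 X0) row01_coord_mx eps_funE. Qed.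

Lemma eps01_differentiable a r : differentiable (eps01 a r) X0.
Proof.
apply: (@differentiable_comp _ _ _ _ row01
  (fun z => eps_fun e (c ord0) (c ord1) z a r)).
  by apply: differentiable_pair; exact: differentiable_row.
by rewrite row01_coord_mx; exact: eps_fun_differentiable.
Qed.

(** [eps01] sees only rows 0 and 1 of the direction, which are the unit vector s and the column s of
    eps(p_0, p_1). Hence the derivative is exactly the expression in the integrability condition. *)
Lemma derive_eps01 a r s : 'D_(hlift c p s) (eps01 a r) X0 =
  eps_total_deriv e (c ord0) (c ord1) (p ord0) (p ord1) a r s.
Proof.
rewrite (@derive_comp_linear _ _ _ _ row01
  (fun z => eps_fun e (c ord0) (c ord1) z a r)); last first.
  by move=> b u v; rewrite /row01 !linearP.
have dE : differentiable (fun z => eps_fun e (c ord0) (c ord1) z a r) (row01 X0).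
  by rewrite row01_coord_mx; exact: eps_fun_differentiable.
rewrite /eps_total_deriv -row01_coord_mx.
rewrite (_ : row01 (hlift c p s) = (delta_mx 0 s, 0) + \sum_(b < n) E b s *: (0, delta_mx 0 b)).
  rewrite derive_addv // derive_sumv //; congr (_ + _).
  by apply: eq_bigr => b _; exact: mulrC.
rewrite (_ : \sum_(b < n) _ = (0, \sum_(b < n) E b s *: delta_mx 0 b)); last first.
  elim/big_rec2: _ => // b y1 y2 _ ->; congr (_, _).
  by rewrite /= scaler0 addr0.
congr (_, _).
  apply/rowP => j; rewrite addr0 mxE mxE eps_coord_refl //.
  by rewrite !mxE eqxx.
apply/rowP => j; rewrite add0r summxE (bigD1 j) //= big1 => [|l lj].
  by rewrite addr0 2!mxE [RHS]mxE [X in _ = _ * X]mxE !eqxx mulr1.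
by rewrite mxE [X in _ * X]mxE eq_sym (negPf lj) andbF mulr0.
Qed.

Lemma hcoord_push_differentiable I : differentiable (hcoord_push I) X0.
Proof.
apply: differentiable_bigsum => J; apply: differentiableM.
  apply: differentiable_comp; first exact: differentiable_rowsub.
  by rewrite rowsub_coord_mx; apply: hcoord_differentiable => i; exact: cp.
by apply: differentiable_bigprod => j; exact: eps01_differentiable.
Qed.

Lemma hcoord_omit_differentiable i I : differentiable (hcoord_omit i I) X0.
Proof.
apply: (@differentiable_comp _ _ _ _ (rowsub (lift (lift ord0 i)))
  (hcoord w (c \o lift (lift ord0 i)) I)).
  exact: differentiable_rowsub.
by rewrite rowsub_coord_mx; apply: hcoord_differentiable => j; exact: cp.
Qed.

Lemma Dtilde_hcoord_omit i r I :
  'D_(hlift c p r) (hcoord_omit i I) X0 =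
  Dtilde e (c \o lift (lift ord0 i)) r (hcoord w (c \o lift (lift ord0 i)) I)
    (p \o lift (lift ord0 i)).
Proof.
have cp' j : chart_around ((c \o lift (lift ord0 i)) j) ((p \o lift (lift ord0 i)) j).
  exact: cp.
rewrite (DtildeE cp' _ (hcoord_differentiable cp' w I)).
rewrite [LHS](derive_comp_linear (L := rowsub _) (hcoord w _ I));
  last exact: rowsub_linear.
by rewrite rowsub_coord_mx (rowsub_hlift0 _ _ _ (lift_liftS i)).
Qed.

(** Product rule: w_J is differentiated through [rowsub_hlift], the eps factors through
    [derive_eps01]. The result has the shape of the left side of [wedge_pullback]. *)
Lemma Dtilde_hcoord_push r I :
  'D_(hlift c p r) (hcoord_push I) X0 =
  \sum_(J : {ffun 'I_k -> 'I_n})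
    ((\sum_(b < n) E b r *
        Dtilde e (c \o lift ord0) b (hcoord w (c \o lift ord0) J) (p \o lift ord0)) *
      (\prod_j E (J j) (I j)) +
     hcoord w (c \o lift ord0) J (coord_mx (c \o lift ord0) (p \o lift ord0)) *
     \sum_j \prod_i (if i == j
       then eps_total_deriv e (c ord0) (c ord1) (p ord0) (p ord1) (J i) (I i) r
       else E (J i) (I i))).
Proof.
have cp' j : chart_around ((c \o lift ord0) j) ((p \o lift ord0) j) by exact: cp.
have dw J : differentiable (hcoord w (c \o lift ord0) J)
    (rowsub (lift ord0) X0).
  by rewrite rowsub_coord_mx; apply: hcoord_differentiable.
have dwX J : differentiable
    (fun X => hcoord w (c \o lift ord0) J (rowsub (lift ord0) X)) X0.
  by apply: differentiable_comp; first exact: differentiable_rowsub.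
have dP J : differentiable (fun X => \prod_j eps01 (J j) (I j) X) X0.
  by apply: differentiable_bigprod => j; exact: eps01_differentiable.
rewrite derive_bigsum => [|J]; last exact: differentiableM.
apply: eq_bigr => J _; rewrite (derive_mul _ (dwX J) (dP J)).
have Dw : 'D_(hlift c p r)
    (fun X => hcoord w (c \o lift ord0) J (rowsub (lift ord0) X)) X0 =
  \sum_(b < n) E b r *
    Dtilde e (c \o lift ord0) b (hcoord w (c \o lift ord0) J) (p \o lift ord0).
  rewrite (derive_comp_linear (L := rowsub (lift ord0)) (hcoord w _ J));
    last exact: rowsub_linear.
  rewrite (rowsub_hlift _ (cp _)) (derive_sumv _ _ (dw J)) rowsub_coord_mx.
  apply: eq_bigr => b _.
  by rewrite (DtildeE cp' _ (hcoord_differentiable cp' w J)).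
have PE : \prod_j eps01 (J j) (I j) X0 = \prod_j E (J j) (I j).
  by apply: eq_bigr => j _; exact: eps01_coord_mx.
have DP : 'D_(hlift c p r) (fun X => \prod_j eps01 (J j) (I j) X) X0 =
    \sum_j \prod_i (if i == j
      then eps_total_deriv e (c ord0) (c ord1) (p ord0) (p ord1) (J i) (I i) r
      else E (J i) (I i)).
  rewrite derive_prod => [|j]; last exact: eps01_differentiable.
  apply: eq_bigr => j _; apply: eq_bigr => i _.
  by rewrite derive_eps01 eps01_coord_mx.
have wE := congr1 (hcoord w (c \o lift ord0) J) (rowsub_coord_mx (lift ord0) c p).
exact: (f_equal2 _ (f_equal2 _ Dw PE) (f_equal2 _ wE DP)).
Qed.

Lemma Dtilde_delta r I :
  Dtilde e c r (hcoord (delta e w) c I) p =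
  'D_(hlift c p r) (hcoord_push I) X0 +
  \sum_(i < m'.+1) (-1) ^+ lift ord0 i * 'D_(hlift c p r) (hcoord_omit i I) X0.
Proof.
rewrite (@Dtilde_near _ c p r _ (fun X => hcoord_push I X +
  \sum_(i < m'.+1) (-1) ^+ lift ord0 i * hcoord_omit i I X)); last first.
  near=> X; apply: hcoord_delta; near: X; exact: coord_mx_near.
have domit (i : 'I_m'.+1) :
    differentiable (fun X => (-1) ^+ lift ord0 i * hcoord_omit i I X) X0.
  by apply: differentiableZ; exact: hcoord_omit_differentiable.
have dpush := hcoord_push_differentiable I.
have dsum := differentiable_bigsum _ domit.
rewrite (DtildeE cp _ (differentiableD dpush (dsum _))).
rewrite [LHS](deriveD (diff_derivable dpush) (diff_derivable (dsum _))).
rewrite (derive_bigsum _ _ domit); congr (_ + _); apply: eq_bigr => i _.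
by apply: deriveZ; apply: diff_derivable; exact: hcoord_omit_differentiable.
Unshelve. all: by end_near. Qed.

End Delta.

End HorizontalForms.

(** * Commutation of d~ and delta *)

Theorem proposition22 (R : realType) (n : nat) (M : manifold R n)
    (e : splitting M) (hLie : local_Lie_group e) (hglob : globalizable e)
    (m' k : nat) (hk : (k < n)%N)
    (c : M -> chart R n M) (hc : forall p : M, chart_around (c p) p)
    (w : hform M m' k) (p : 'I_m'.+2 -> M) (A : 'M[R]_(n, k.+1)) :
  dtilde e c (delta e w) p A = delta e (dtilde e c w) p A.
Proof.
have cp i : chart_around ((c \o p) i) (p i) by exact: hc.
have DE r I := etrans (Dtilde_delta e w (fun i => (cp i).1) cp r I)
  (f_equal2 +%R (Dtilde_hcoord_push e w cp r I) (eq_bigr _ (fun i _ =>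
    congr1 _ (Dtilde_hcoord_omit e w cp i r I)))).
rewrite {1}/dtilde.
under eq_bigr => r _ do under eq_bigr => I _ do rewrite DE.
rewrite sum_mul_split [RHS]/delta [RHS]big_ord_recl expr0 mul1r; congr (_ + _).
  (* The i = 0 term: integrability is the symmetry required of S. *)
  rewrite wedge_pullback; last by move=> a r s; exact: hLie.
  rewrite /push -eps_inv /dtilde; congr (_ * _).
  apply: eq_bigr => b _; apply: eq_bigr => J _; congr (_ * wedge_dx _ _).
  (* Transporting the arguments by eps(p_0, p_1) and then taking components at p_1 equals taking
     components at p_0 and applying the coordinate matrix of eps. *)
  by apply: esym; apply: conj_mulmx; exact: frame_unit.
(* For i > 0 the first point is still p_0, so both sides use the same frame and no transport. *)
apply: eq_bigr => i _; congr (_ * _).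
by rewrite (push_lift0 e p _ _ (lift_liftS i)) /dtilde /= lift_liftS.
Qed.
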